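(* Assume that $p$ is a prime with $p\ne3$. Let $$\begin{aligned} O_1&=G(\langle x^p\rangle\oplus W),\\ O_2&=G(V\oplus\langle(x,x,y)\rangle),\\ O_3&=G(\langle x^p,\ y^p+(x,y,y),\ (x,x,y)\rangle),\\ O_4&=G(\langle y^p,\ x^p+(x,y,y),\ (x,x,y)\rangle),\\ O_5&=G(\langle y^p,\ \lambda x^p+(x,y,y),\ (x,x,y)\rangle), \end{aligned}$$ where $\lambda$ is not a square in $\mathbb Z_p$. (When $p=2$, every element of $\mathbb Z_p$ is a square, and we let $O_5=\emptyset$.) Then $O_1\cup O_2\cup O_3\cup O_4\cup O_5$ is a disjoint union of all $3$-dimensional subspaces of $Z(F_p)$.
   Context: Elements of $\mathbb Z_p$ are identified with the integers $0,\dots,p-1$. For $0\le a,b<p$ let $(a,b)_p=0$ if $a+b<p$ and $(a,b)_p=1$ otherwise. $F_p$ is the commutative automorphic loop on $(\mathbb Z_p)^6$ with multiplication $$(a_1,\dots,a_6)(b_1,\dots,b_6)=(a_1+b_1,\ a_2+b_2,\ a_3+b_3+(a_1,b_1)_p,\ a_4+b_4+(a_2,b_2)_p,\ a_5+b_5-a_1b_1(a_2+b_2),\ a_6+b_6+a_2b_2(a_1+b_1)).$$ It is generated by $x=(1,0,0,0,0,0)$ and $y=(0,1,0,0,0,0)$. The associator is defined by $(ab)c=(a(bc))(a,b,c)$. The center $Z(F_p)=0\times0\times(\mathbb Z_p)^4$ is written additively as a $4$-dimensional vector space over $\mathbb Z_p$ with basis $x^p=(0,0,1,0,0,0)$, $y^p=(0,0,0,1,0,0)$,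 $(x,x,y)=(0,0,0,0,1,0)$, $(x,y,y)=(0,0,0,0,0,1)$. Let $V=\langle x^p\rangle\oplus\langle y^p\rangle$ and $W=\langle(x,x,y)\rangle\oplus\langle(x,y,y)\rangle$, where $\langle\cdot\rangle$ denotes linear span. The group $G=\mathrm{GL}_2(p)$ acts on $Z(F_p)$: $\rho=\begin{pmatrix}\alpha_1&\alpha_2\\ \beta_1&\beta_2\end{pmatrix}$ acts as the restriction to $Z(F_p)$ of the automorphism $\widehat\rho$ of $F_p$ determined by $\widehat\rho(x)=x^{\alpha_1}y^{\alpha_2}=(\alpha_1,\alpha_2,0,0,0,0)$, $\widehat\rho(y)=x^{\beta_1}y^{\beta_2}=(\beta_1,\beta_2,0,0,0,0)$. For a subspace $N$ of $Z(F_p)$, $G(N)=\{\widehat\rho(N):\rho\in G\}$ denotes its orbit. *)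

(* Defs.v *)
From HB Require Import structures.
From mathcomp Require Import all_boot all_order all_fingroup all_algebra.
From mathcomp Require Import ring zify.

Set Implicit Arguments.
Unset Strict Implicit.
Unset Printing Implicit Defensive.

Import GRing.Theory.
Local Open Scope ring_scope.

(* The carrier of the loop F_p is 'rV['F_p]_6.  All definitions below are meant
   for prime p: otherwise 'F_p is the field of order pdiv p, not Z/p. *)

Section Loop.
Variable p : nat.

Definition row6 (a1 a2 a3 a4 a5 a6 : 'F_p) : 'rV['F_p]_6 :=
  \row_(i < 6) [:: a1; a2; a3; a4; a5; a6]`_i.

(* Coordinates are numbered from 1 to 6. *)
Definition co (v : 'rV['F_p]_6) (k : nat) : 'F_p := v 0 (inord k.-1).

Definition carry (a b : 'F_p) : 'F_p :=
  if (nat_of_ord a + nat_of_ord b < p)%N then 0 else 1.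

Definition lmul (a b : 'rV['F_p]_6) : 'rV['F_p]_6 :=
  row6 (co a 1 + co b 1)
       (co a 2 + co b 2)
       (co a 3 + co b 3 + carry (co a 1) (co b 1))
       (co a 4 + co b 4 + carry (co a 2) (co b 2))
       (co a 5 + co b 5 - co a 1 * co b 1 * (co a 2 + co b 2))
       (co a 6 + co b 6 + co a 2 * co b 2 * (co a 1 + co b 1)).

(* The identity element of the loop is the zero vector. *)
Definition lpow (a : 'rV['F_p]_6) (n : nat) : 'rV['F_p]_6 := iter n (lmul a) 0.

Definition ldiv (a b : 'rV['F_p]_6) : 'rV['F_p]_6 :=
  odflt 0 [pick d | lmul a d == b].

(* (ab)c = (a(bc))(a,b,c); see lmul_associator and associator_unique. *)
Definition associator (a b c : 'rV['F_p]_6) : 'rV['F_p]_6 :=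
  ldiv (lmul a (lmul b c)) (lmul (lmul a b) c).

Definition lcenter : {set 'rV['F_p]_6} :=
  [set z | [forall a, forall b,
    [&& lmul z a == lmul a z,
        lmul (lmul z a) b == lmul z (lmul a b),
        lmul (lmul a z) b == lmul a (lmul z b) &
        lmul (lmul a b) z == lmul a (lmul b z)]]].

Definition is_laut (f : {perm 'rV['F_p]_6}) : bool :=
  [forall a, forall b, f (lmul a b) == lmul (f a) (f b)].

Definition gx : 'rV['F_p]_6 := row6 1 0 0 0 0 0.
Definition gy : 'rV['F_p]_6 := row6 0 1 0 0 0 0.

Definition xp : 'rV['F_p]_6 := lpow gx p.
Definition yp : 'rV['F_p]_6 := lpow gy p.
Definition xxy : 'rV['F_p]_6 := associator gx gx gy.
Definition xyy : 'rV['F_p]_6 := associator gx gy gy.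

(* f is the automorphism induced by the matrix rho: its rows are
   (alpha_1, alpha_2) and (beta_1, beta_2), and x and y are sent to
   x^alpha_1 y^alpha_2 and x^beta_1 y^beta_2. *)
Definition is_hat (rho : 'M['F_p]_2) (f : {perm 'rV['F_p]_6}) : bool :=
  [&& is_laut f,
      f gx == lmul (lpow gx (rho 0 0)) (lpow gy (rho 0 1)) &
      f gy == lmul (lpow gx (rho 1 0)) (lpow gy (rho 1 1))].

Definition Gorbit (N : {vspace 'rV['F_p]_6}) : {set {set 'rV['F_p]_6}} :=
  [set f @: [set v in N] | f : {perm 'rV['F_p]_6}
     & [exists rho in (@unitmx 'F_p 2), is_hat rho f]].

(* On the center the loop operation is vector addition (see lmul_center), so
   subspaces of the center are subspaces of 'rV['F_p]_6 contained in it. *)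
Definition VF : {vspace 'rV['F_p]_6} := (<[xp]> + <[yp]>)%VS.
Definition WF : {vspace 'rV['F_p]_6} := (<[xxy]> + <[xyy]>)%VS.

Definition is_subspace_of_center (d : nat) (S : {set 'rV['F_p]_6}) : Prop :=
  exists U : {vspace 'rV['F_p]_6},
    [/\ S = [set v in U], S \subset lcenter & \dim U = d].

Definition O1 := Gorbit (<[xp]> + WF)%VS.
Definition O2 := Gorbit (VF + <[xxy]>)%VS.
Definition O3 := Gorbit <<[:: xp; (yp + xyy)%R; xxy]>>%VS.
Definition O4 := Gorbit <<[:: yp; (xp + xyy)%R; xxy]>>%VS.
Definition O5 (lambda : 'F_p) : {set {set 'rV['F_p]_6}} :=
  if p == 2 then set0 else Gorbit <<[:: yp; (lambda *: xp + xyy)%R; xxy]>>%VS.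

Lemma co_row6 a1 a2 a3 a4 a5 a6 :
  (co (row6 a1 a2 a3 a4 a5 a6) 1 = a1) * (co (row6 a1 a2 a3 a4 a5 a6) 2 = a2)
  * (co (row6 a1 a2 a3 a4 a5 a6) 3 = a3) * (co (row6 a1 a2 a3 a4 a5 a6) 4 = a4)
  * (co (row6 a1 a2 a3 a4 a5 a6) 5 = a5) * (co (row6 a1 a2 a3 a4 a5 a6) 6 = a6).
Proof. by rewrite /co !mxE !inordK. Qed.

Lemma row6E v : v = row6 (co v 1) (co v 2) (co v 3) (co v 4) (co v 5) (co v 6).
Proof.
apply/rowP=> -[[|[|[|[|[|[|i]]]]]] hi] //; rewrite !mxE /= /co;
  by congr (v _ _); apply/val_inj; rewrite /= inordK.
Qed.

Lemma co0 k : co 0 k = 0.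
Proof. by rewrite /co mxE. Qed.

Lemma row6_0 : row6 0 0 0 0 0 0 = 0.
Proof. by rewrite [RHS]row6E !co0. Qed.

Lemma coD u v k : co (u + v) k = co u k + co v k.
Proof. by rewrite /co mxE. Qed.

Lemma coZ (c : 'F_p) v k : co (c *: v) k = c * co v k.
Proof. by rewrite /co mxE. Qed.

Lemma carryC a b : carry a b = carry b a.
Proof. by rewrite /carry addnC. Qed.

Lemma lmulC a b : lmul a b = lmul b a.
Proof.
by rewrite /lmul; congr row6; rewrite 1?(carryC (co b _)); ring.
Qed.

Hypothesis p_pr : prime p.

Lemma val_Fp_lt (a : 'F_p) : (a < p)%N.
Proof. by have := ltn_ord a; rewrite [X in (_ < X)%N]Fp_cast. Qed.

Lemma val_FpD (a b : 'F_p) :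
  nat_of_ord (a + b) = (if (a + b < p)%N then a + b else a + b - p)%N.
Proof.
have -> : nat_of_ord (a + b) = ((a + b) %% p)%N.
  by rewrite -[RHS](congr1 (modn (a + b)) (Fp_cast p_pr)).
have := val_Fp_lt a; have := val_Fp_lt b; case: ifPn => [h|h] ha hb.
  by rewrite modn_small.
rewrite -{1}(@subnK p (a + b)) ?modnDr ?modn_small //; lia.
Qed.

Lemma carryE (a b : 'F_p) : carry a b = (~~ (a + b < p)%N : nat)%:R.
Proof. by rewrite /carry; case: ifP. Qed.

Lemma carry_cocycle a b c :
  carry a b + carry (a + b) c = carry b c + carry a (b + c).
Proof.
rewrite !carryE -!natrD !val_FpD; congr (_%:R).
have := val_Fp_lt a; have := val_Fp_lt b; have := val_Fp_lt c.
set x := nat_of_ord a; set y := nat_of_ord b; set z := nat_of_ord c.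
by case: (ltnP (x + y)); case: (ltnP (y + z)) => h1 h2 hz hy hx;
  case: ltnP => h3; case: ltnP => h4 /=; lia.
Qed.

Lemma carry0 a : (carry a 0 = 0) * (carry 0 a = 0).
Proof. by rewrite /carry /= addn0 add0n val_Fp_lt. Qed.

Lemma lmul0 a : (lmul a 0 = a) * (lmul 0 a = a).
Proof.
split; rewrite /lmul !co0 !carry0 [RHS]row6E; congr row6; ring.
Qed.

Lemma lmul_inj a : injective (lmul a).
Proof.
move=> b b' e; rewrite [b]row6E [b']row6E.
move/(congr1 co): e => e.
have e1 : co b 1 = co b' 1.
  by move/(congr1 (@^~ 1%N)): e; rewrite /lmul !co_row6 => /addrI.
have e2 : co b 2 = co b' 2.
  by move/(congr1 (@^~ 2%N)): e; rewrite /lmul !co_row6 => /addrI.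
congr row6 => //.
- by move/(congr1 (@^~ 3%N)): e; rewrite /lmul !co_row6 e1 => /addIr /addrI.
- by move/(congr1 (@^~ 4%N)): e; rewrite /lmul !co_row6 e2 => /addIr /addrI.
- by move/(congr1 (@^~ 5%N)): e; rewrite /lmul !co_row6 e1 e2 => /addIr /addrI.
- by move/(congr1 (@^~ 6%N)): e; rewrite /lmul !co_row6 e1 e2 => /addIr /addrI.
Qed.

Lemma ldivK a b : lmul a (ldiv a b) = b.
Proof.
rewrite /ldiv; case: pickP => [d /eqP //|no].
have /codomP[d e] : b \in codom (lmul a).
  exact: (injF_onto (@lmul_inj a)).
by have := no d; rewrite -e eqxx.
Qed.

Lemma lmul_associator a b c :
  lmul (lmul a b) c = lmul (lmul a (lmul b c)) (associator a b c).
Proof. by rewrite ldivK. Qed.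

Lemma associator_unique a b c d :
  lmul (lmul a b) c = lmul (lmul a (lmul b c)) d -> d = associator a b c.
Proof. by rewrite lmul_associator => /lmul_inj. Qed.

Lemma associatorE a b c : associator a b c =
  row6 0 0 0 0 (co b 1 * (co a 1 * co c 2 - co a 2 * co c 1))
               (co b 2 * (co a 1 * co c 2 - co a 2 * co c 1)).
Proof.
apply/esym/associator_unique; rewrite /lmul !co_row6 !carry0.
have h k : carry (co a k + co b k) (co c k) = carry (co b k) (co c k)
    + carry (co a k) (co b k + co c k) - carry (co a k) (co b k).
  by rewrite -carry_cocycle; ring.
by rewrite !h; congr row6; ring.
Qed.

Lemma associator_eq0 a b c :
  (lmul (lmul a b) c == lmul a (lmul b c)) = (associator a b c == 0).
Proof.
apply/eqP/eqP=> [e|e]; last by rewrite lmul_associator e lmul0.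
by apply/esym/associator_unique; rewrite lmul0.
Qed.

Lemma lcenterP z : reflect (co z 1 = 0 /\ co z 2 = 0) (z \in lcenter).
Proof.
rewrite inE; apply: (iffP idP) => [/forallP h|[z1 z2]].
  have zero6 u v : row6 0 0 0 0 u v = 0 -> u = 0 /\ v = 0.
    move/(congr1 co)=> e; split.
      by have := congr1 (@^~ 5%N) e; rewrite co_row6 co0.
    by have := congr1 (@^~ 6%N) e; rewrite co_row6 co0.
  have /forallP/(_ gy)/and4P[_ h1 _ _] := h gx.
  have /forallP/(_ gx)/and4P[_ h2 _ _] := h gx.
  move: h1 h2; rewrite !associator_eq0 !associatorE !co_row6.
  move=> /eqP/zero6[+ _] /eqP/zero6[+ _].
  rewrite !(mul1r, mulr1, mulr0, subr0, sub0r) => -> /eqP.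
  by rewrite oppr_eq0 => /eqP.
apply/forallP=> a; apply/forallP=> b.
apply/and4P; split; first by rewrite lmulC.
all: by rewrite associator_eq0 associatorE z1 z2 !(mul0r, mulr0, subr0) row6_0.
Qed.

Lemma lmul_center : {in lcenter &, forall a b, lmul a b = a + b}.
Proof.
move=> a b /lcenterP[a1 a2] /lcenterP[b1 b2].
rewrite [RHS]row6E !coD /lmul a1 a2 b1 b2 !carry0; congr row6; ring.
Qed.

Lemma val_Fp_small n : (n < p)%N -> nat_of_ord (n%:R : 'F_p) = n.
Proof. by move=> hn; rewrite val_Fp_nat // modn_small. Qed.

Lemma carry1n n : (n < p)%N ->
  carry 1 n%:R = (if n.+1 == p then 1 else 0).
Proof.
move=> hn; rewrite /carry -{1}[1]/(1%:R) !val_Fp_small ?prime_gt1 // add1n.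
by case: ltngtP => //; lia.
Qed.

Lemma lpow_gx n : (n < p)%N -> lpow gx n = row6 n%:R 0 0 0 0 0.
Proof.
elim: n => [|n IH] hn; first by rewrite row6_0.
rewrite [LHS]/= -/(lpow gx n) IH 1?ltnW // /lmul !co_row6 carry1n 1?ltnW //.
by rewrite ltn_eqF // carry0 -natr1; congr row6; ring.
Qed.

Lemma lpow_gy n : (n < p)%N -> lpow gy n = row6 0 n%:R 0 0 0 0.
Proof.
elim: n => [|n IH] hn; first by rewrite row6_0.
rewrite [LHS]/= -/(lpow gy n) IH 1?ltnW // /lmul !co_row6 carry1n 1?ltnW //.
by rewrite ltn_eqF // carry0 -natr1; congr row6; ring.
Qed.

Lemma xpE : xp = row6 0 0 1 0 0 0.
Proof.
have p0 := prime_gt0 p_pr; have Ep : 1 + p.-1%:R = 0 :> 'F_p.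
  by rewrite addrC natr1 prednK // pchar_Fp_0.
rewrite /xp -{2}(prednK p0) [LHS]/= -/(lpow gx _) lpow_gx ?prednK //.
rewrite /lmul !co_row6 carry1n ?prednK // eqxx carry0.
by congr row6; [rewrite Ep|ring|ring|ring|ring|ring].
Qed.

Lemma ypE : yp = row6 0 0 0 1 0 0.
Proof.
have p0 := prime_gt0 p_pr; have Ep : 1 + p.-1%:R = 0 :> 'F_p.
  by rewrite addrC natr1 prednK // pchar_Fp_0.
rewrite /yp -{2}(prednK p0) [LHS]/= -/(lpow gy _) lpow_gy ?prednK //.
rewrite /lmul !co_row6 carry1n ?prednK // eqxx carry0.
by congr row6; [ring|rewrite Ep|ring|ring|ring|ring].
Qed.

Lemma xxyE : xxy = row6 0 0 0 0 1 0.
Proof. by rewrite /xxy associatorE !co_row6; congr row6; ring. Qed.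

Lemma xyyE : xyy = row6 0 0 0 0 0 1.
Proof. by rewrite /xyy associatorE !co_row6; congr row6; ring. Qed.

Lemma lmul_pow (a b : 'F_p) :
  lmul (lpow gx a) (lpow gy b) = row6 a b 0 0 0 0.
Proof.
rewrite lpow_gx ?val_Fp_lt // lpow_gy ?val_Fp_lt // !natr_Zp /lmul !co_row6.
by rewrite !carry0; congr row6; ring.
Qed.

End Loop.

(* Main.v *)
Require Import Defs.
From mathcomp Require Import all_boot all_order all_fingroup all_algebra.
From mathcomp Require Import cyclic finfield.
From mathcomp Require Import ring zify.

Set Implicit Arguments.
Unset Strict Implicit.
Unset Printing Implicit Defensive.

Import GRing.Theory.
Local Open Scope ring_scope.

(** The statement is dual to the classification of hyperplanes of the center.
    A 3-dimensional subspace of the 4-dimensional center Z = V + W is the kernel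
    of a nonzero functional, that is, of a pair (u, w) of columns of length 2,
    u acting on V and w on W, unique up to a nonzero scalar
    ([center_subspace_hyperplane], [hyperplane_subset]).

    The automorphism of F_p attached to rho acts on V by rho and on W by
    det(rho) rho: the associator (a,b,c) only sees the first two coordinates,
    where it is b times the determinant of a and c. So the hyperplane of
    (rho u, det(rho) rho w) is carried onto the hyperplane of (u, w)
    ([hat_fun_hyperplane]), and the orbits are those of GL_2 on pairs (u, w) up
    to scalars. If w = 0, or u = 0, or u and w are both nonzero and parallel,
    there is one orbit each, because u (or w) can be moved to any nonzero vector
    by a matrix of any determinant. If u and w are independent, the determinant
    [cross u w] of the matrix with columns u and w is multiplied by a nonzero
    square, and its class modulo squares is the only invariant
    ([equivalent_skew]); the class of -1 gives O4 and the class of -lambda gives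
    O5. These are all the classes, since the squares have index at most 2 in the
    multiplicative group of a finite field ([nonsquare_ratio]).

    What needs work is the existence of the automorphism for every invertible
    rho. In the coordinates 5 and 6 the loop is given by symmetric cubic
    cocycles, and an automorphism exists when the transformed cocycle differs
    from a linear combination of the old ones by the coboundary of a cubic
    polynomial. That polynomial ([cubic]) contains a1^3 / 3, which is where
    p <> 3 enters. In the coordinates 3 and 4 the loop is the abelian group
    (Z/p^2)^2 written in base p, on which an integer matrix acts; the carry
    produced by that action is [wrap]. An automorphism is determined by the
    images of x and y, so this explicit map is the only one ([is_hatP]). *)

Local Notation square x := [exists m, x == m ^+ 2].

(** * Columns and matrices of size 2 *)

Lemma det_mx22 (R : comNzRingType) (A : 'M[R]_2) :
  \det A = A 0 0 * A 1 1 - A 0 1 * A 1 0.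
Proof.
rewrite (expand_det_row _ ord0) !big_ord_recl big_ord0 /cofactor !det_mx11.
have e1 : lift ord0 ord0 = 1 :> 'I_2 by apply/val_inj.
have e0 : lift 1 ord0 = 0 :> 'I_2 by apply/val_inj.
rewrite !mxE /= !e1 !e0 !addn0 !addn1.
by rewrite -![ord0]/(0 : 'I_2) expr1 expr0; ring.
Qed.

Section Dimension2.
Variable F : fieldType.

Definition col2 (a b : F) : 'cV[F]_2 := \col_i (if i == 0 then a else b).
Definition mat2 (a b c d : F) : 'M[F]_2 :=
  \matrix_(i, j) if i == 0 then if j == 0 then a else b
                 else if j == 0 then c else d.

Lemma col2E a b : (col2 a b 0 0 = a) * (col2 a b 1 0 = b).
Proof. by rewrite !mxE. Qed.

Lemma mat2E a b c d (m := mat2 a b c d) :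
  (m 0 0 = a) * (m 0 1 = b) * (m 1 0 = c) * (m 1 1 = d).
Proof. by rewrite !mxE. Qed.

Lemma eq_col2 (u v : 'cV[F]_2) : u 0 0 = v 0 0 -> u 1 0 = v 1 0 -> u = v.
Proof.
move=> e0 e1; apply/colP => -[[|[|//]] i].
  by rewrite (_ : Ordinal i = 0) //; apply/val_inj.
by rewrite (_ : Ordinal i = 1) //; apply/val_inj.
Qed.

Lemma scale_colE n (d : F) (u : 'cV[F]_n) i : (d *: u) i 0 = d * u i 0.
Proof. by rewrite mxE. Qed.

Lemma mulmx2E (m : 'M[F]_2) (u : 'cV[F]_2) i :
  (m *m u) i 0 = m i 0 * u 0 0 + m i 1 * u 1 0.
Proof.
by rewrite mxE !big_ord_recl big_ord0 addr0 (_ : lift ord0 ord0 = 1) //; apply/val_inj.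
Qed.

Lemma unitmx2_inj (m : 'M[F]_2) (s t s' t' : F) : m \in unitmx ->
  s * m 0 0 + t * m 1 0 = s' * m 0 0 + t' * m 1 0 ->
  s * m 0 1 + t * m 1 1 = s' * m 0 1 + t' * m 1 1 -> s = s' /\ t = t'.
Proof.
rewrite unitmxE unitfE => d0 e0 e1; split; apply: (mulfI d0); rewrite det_mx22.
  transitivity (m 1 1 * (s * m 0 0 + t * m 1 0)
                - m 1 0 * (s * m 0 1 + t * m 1 1)); first by ring.
  by rewrite e0 e1; ring.
transitivity (m 0 0 * (s * m 0 1 + t * m 1 1)
              - m 0 1 * (s * m 0 0 + t * m 1 0)); first by ring.
by rewrite e0 e1; ring.
Qed.

End Dimension2.

(** * Squares in a finite field *)

(** Both elements are odd powers of a generator of the multiplicative group, so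
    their product is an even power. *)
Lemma nonsquare_ratio (F : finFieldType) (a b : F) :
  ~~ square a -> ~~ square b ->
  exists s, s ^+ 2 * a = b.
Proof.
have /cyclicP[g gen] := field_unit_group_cyclic [set: {unit F}]%G.
have power (x : F) : ~~ square x ->
    exists2 i, odd i & x = val g ^+ i.
  move=> nsq; have x0 : x != 0.
    by apply: contraNneq nsq => ->; apply/'exists_eqP; exists 0; rewrite expr0n.
  have : FinRing.unit F (etrans (unitfE x) x0) \in <[g]>%g by rewrite -gen inE.
  case/cycleP => i /(congr1 val); rewrite /= FinRing.val_unitX => e.
  exists i => //; apply: contraNT nsq => even_i; apply/'exists_eqP.
  exists (val g ^+ i./2); rewrite -exprM e muln2.
  by rewrite -[in LHS](odd_double_half i) (negPf even_i).
move=> /power[i odd_i ->] /power[j odd_j ->].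
have g0 : val g != 0 by rewrite -unitfE; exact: valP g.
(* The witness is a square root of a * b, divided by a. *)
exists (val g ^+ (i + j)./2 / val g ^+ i).
have : (i + j = (i + j)./2 * 2)%N.
  by rewrite muln2 -[LHS]odd_double_half oddD odd_i odd_j.
rewrite exprMn -exprM => <-; rewrite exprD exprVn; field.
by rewrite expf_neq0.
Qed.

(** * The automorphism attached to a matrix *)

(** Turns an equation that follows from another one by moving terms across into
    an identity of polynomials. *)
Lemma eq_of_subr (V : zmodType) (s t u v : V) :
  s = t -> u - v = s - t -> u = v.
Proof. by move=> ->; rewrite subrr => /subr0_eq. Qed.

Section FpLoop.
Variables (p : nat).
Hypotheses (p_pr : prime p) (p_neq3 : p <> 3%N).
Local Notation vec := 'rV['F_p]_6.
Implicit Types (a b c z : vec) (rho : 'M['F_p]_2) (f g : {perm vec}).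

Lemma three_neq0 : 3%:R != 0 :> 'F_p.
Proof.
rewrite -(dvdn_pcharf (pchar_Fp p_pr)) dvdn_prime2 //.
by apply/eqP.
Qed.

(** In base p, the carry of m (a + p a') + n (b + p b') out of the lowest digit
    that a and b produce; the quotient is taken on representatives in
    0 .. p-1. *)
Definition wrap (m n a b : 'F_p) : 'F_p := ((m * a + n * b)%N %/ p)%:R.

(** Both sides count the multiples of p removed from
    m (a1 + b1) + n (a2 + b2), computed in the natural numbers: either the sums
    a_i + b_i are reduced first, or the two combinations are reduced first. *)
Lemma wrap_carry (m n a1 a2 b1 b2 : 'F_p) :
  wrap m n (a1 + b1) (a2 + b2) + m * carry a1 b1 + n * carry a2 b2
  = wrap m n a1 a2 + wrap m n b1 b2
    + carry (a1 * m + a2 * n) (b1 * m + b2 * n).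
Proof.
have p0 := prime_gt0 p_pr.
have val_sum (s t : 'F_p) :
    nat_of_ord (s + t) = (s + t - p * ~~ (s + t < p)%N)%N.
  by rewrite val_FpD //; case: ltnP => /=; lia.
have val_comb (s t : 'F_p) :
    nat_of_ord (s * m + t * n) = ((m * s + n * t)%N %% p)%N.
  by rewrite -val_Fp_nat // natrD !natrM !natr_Zp; congr nat_of_ord; ring.
rewrite !carryE -{2}(natr_Zp m) -{2}(natr_Zp n) /wrap -!natrM -!natrD.
congr (_%:R); rewrite !val_comb !val_sum.
set eps1 := nat_of_bool _; set eps2 := nat_of_bool _.
have le1 : (p * eps1 <= a1 + b1)%N by rewrite /eps1; case: ltnP => /=; lia.
have le2 : (p * eps2 <= a2 + b2)%N by rewrite /eps2; case: ltnP => /=; lia.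
set A := (m * a1 + n * a2)%N; set B := (m * b1 + n * b2)%N.
have -> : (m * (a1 + b1 - p * eps1) + n * (a2 + b2 - p * eps2)
           = A + B - (m * eps1 + n * eps2) * p)%N.
  rewrite /A /B; nia.
have le3 : ((m * eps1 + n * eps2) * p <= A + B)%N by rewrite /A /B; nia.
have : ((A + B - (m * eps1 + n * eps2) * p) %/ p + (m * eps1 + n * eps2)
        = (A + B) %/ p)%N.
  by rewrite [LHS]addnC -divnMDl // [X in (X %/ p)%N]addnC subnK.
rewrite -addnA => ->; rewrite divnD //; congr (_ + _ + nat_of_bool _)%N; lia.
Qed.

(** The cubic polynomial whose coboundary corrects the cocycles in the
    coordinates 5 and 6. Replacing a^3 by a^3 - a subtracts a linear form, which
    leaves the coboundary unchanged and makes the polynomial vanish at (1, 0)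
    and (0, 1), so that x and y get the prescribed images. *)
Definition cubic (m m' n n' a b : 'F_p) : 'F_p :=
  m ^+ 2 * m' * (a ^+ 3 - a) / 3%:R + m * m' * n * a ^+ 2 * b
  + m * n * n' * a * b ^+ 2 + n ^+ 2 * n' * (b ^+ 3 - b) / 3%:R.

(** The terms in a1 b1 (a1 + b1) and a2 b2 (a2 + b2) are coboundaries of a^3 / 3
    and b^3 / 3; the mixed ones are coboundaries of a^2 b and a b^2 up to the
    cocycles of the loop, which appear with the coefficient d. *)
Lemma cubic_cocycle (m m' n n' a1 a2 b1 b2 : 'F_p) :
  let d := m * n' - m' * n in
  cubic m m' n n' (a1 + b1) (a2 + b2)
  - cubic m m' n n' a1 a2 - cubic m m' n n' b1 b2
  = (a1 * m + a2 * n) * (b1 * m + b2 * n)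
      * (a1 * m' + a2 * n' + (b1 * m' + b2 * n'))
    + d * (n * (a2 * b2 * (a1 + b1)) - m * (a1 * b1 * (a2 + b2))).
Proof. by rewrite /cubic /=; field; exact: three_neq0. Qed.

Definition hat_fun rho a : vec :=
  row6 (co a 1 * rho 0 0 + co a 2 * rho 1 0)
       (co a 1 * rho 0 1 + co a 2 * rho 1 1)
       (co a 3 * rho 0 0 + co a 4 * rho 1 0
          + wrap (rho 0 0) (rho 1 0) (co a 1) (co a 2))
       (co a 3 * rho 0 1 + co a 4 * rho 1 1
          + wrap (rho 0 1) (rho 1 1) (co a 1) (co a 2))
       (\det rho * (co a 5 * rho 0 0 + co a 6 * rho 1 0)
          - cubic (rho 0 0) (rho 0 1) (rho 1 0) (rho 1 1) (co a 1) (co a 2))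
       (\det rho * (co a 5 * rho 0 1 + co a 6 * rho 1 1)
          + cubic (rho 0 1) (rho 0 0) (rho 1 1) (rho 1 0) (co a 1) (co a 2)).

(** The coordinate 6 is the coordinate 5 with the columns of rho exchanged; this
    changes the sign of the determinant, hence the sign in front of [cubic]. *)
Lemma hat_fun_lmul rho a b :
  hat_fun rho (lmul a b) = lmul (hat_fun rho a) (hat_fun rho b).
Proof.
rewrite /hat_fun /lmul !co_row6 det_mx22.
have cub m m' n n' := cubic_cocycle m m' n n' (co a 1) (co a 2) (co b 1) (co b 2).
have wr m n := wrap_carry m n (co a 1) (co a 2) (co b 1) (co b 2).
congr row6.
- by ring.
- by ring.
- by apply: (eq_of_subr (wr (rho 0 0) (rho 1 0))); ring.
- by apply: (eq_of_subr (wr (rho 0 1) (rho 1 1))); ring.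
- apply/esym/(eq_of_subr (cub (rho 0 0) (rho 0 1) (rho 1 0) (rho 1 1))).
  by ring.
- apply: (eq_of_subr (cub (rho 0 1) (rho 0 0) (rho 1 1) (rho 1 0))).
  by ring.
Qed.

Lemma hat_fun_inj rho : rho \in unitmx -> injective (hat_fun rho).
Proof.
move=> Urho a b e.
have inj2 := unitmx2_inj Urho.
have d0 : \det rho != 0 by rewrite -unitfE -unitmxE.
move/(congr1 (@co p)): e => e.
have {e} ek k := congr1 (@^~ k) e; rewrite /hat_fun in ek.
have := ek 1%N; have := ek 2%N; have := ek 3%N; have := ek 4%N.
have := ek 5%N; have := ek 6%N; rewrite !co_row6 => e6 e5 e4 e3 e2 e1.
have [ea1 ea2] := inj2 _ _ _ _ e1 e2.
move: e3 e4 e5 e6; rewrite ea1 ea2.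
move=> /addIr e3 /addIr e4 /addIr/(mulfI d0) e5 /addIr/(mulfI d0) e6.
have [ea3 ea4] := inj2 _ _ _ _ e3 e4; have [ea5 ea6] := inj2 _ _ _ _ e5 e6.
by rewrite [a]row6E [b]row6E ea1 ea2 ea3 ea4 ea5 ea6.
Qed.

Lemma hat_fun_gx rho :
  hat_fun rho (gx p) = lmul (lpow (gx p) (rho 0 0)) (lpow (gy p) (rho 0 1)).
Proof.
rewrite lmul_pow // /hat_fun !co_row6 /wrap -[1]/(1%:R) val_Fp_small ?prime_gt1 //.
rewrite !muln1 !muln0 !addn0 !divn_small ?val_Fp_lt //.
by rewrite /cubic; congr row6; ring.
Qed.

Lemma hat_fun_gy rho :
  hat_fun rho (gy p) = lmul (lpow (gx p) (rho 1 0)) (lpow (gy p) (rho 1 1)).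
Proof.
rewrite lmul_pow // /hat_fun !co_row6 /wrap -[1]/(1%:R) val_Fp_small ?prime_gt1 //.
rewrite !muln1 !muln0 !add0n !divn_small ?val_Fp_lt //.
by rewrite /cubic; congr row6; ring.
Qed.

Lemma laut_lpow f a n : is_laut f -> f (lpow a n) = lpow (f a) n.
Proof.
move=> /'forall_forallP fM.
have f0 : f 0 = 0.
  by apply: (@lmul_inj p (f 0)); rewrite -(eqP (fM _ _)) !lmul0.
by elim: n => [|n IH] //=; rewrite (eqP (fM _ _)) IH.
Qed.

Lemma laut_associator f a b c :
  is_laut f -> f (associator a b c) = associator (f a) (f b) (f c).
Proof.
move=> /'forall_forallP fM; apply: associator_unique => //.
by rewrite -!(eqP (fM _ _)) lmul_associator.
Qed.

Lemma lpow_center z n : z \in lcenter p -> lpow z n = z *+ n.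
Proof.
move=> zZ; elim: n => [|n IH] //=; rewrite IH mulrS lmul_center //.
by apply/lcenterP; rewrite // -scaler_nat !coZ; case/(lcenterP p_pr): zZ => -> ->;
   rewrite mulr0.
Qed.

(** F_p is generated by x and y: the factors x^p, y^p, (x,x,y), (x,y,y) of this
    normal form are themselves expressions in x and y. *)
Lemma generation a : a =
  lmul (lmul (lpow (gx p) (co a 1)) (lpow (gy p) (co a 2)))
       (lmul (lmul (lpow (xp p) (co a 3)) (lpow (yp p) (co a 4)))
             (lmul (lpow (xxy p) (co a 5)) (lpow (xyy p) (co a 6)))).
Proof.
have c6 (c d e g : 'F_p) : row6 0 0 c d e g \in lcenter p.
  by apply/lcenterP; rewrite // !co_row6.
have scale6 (t a1 a2 a3 a4 a5 a6 : 'F_p) : t *: row6 a1 a2 a3 a4 a5 a6 =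
    row6 (t * a1) (t * a2) (t * a3) (t * a4) (t * a5) (t * a6).
  by rewrite [LHS]row6E !coZ !co_row6.
have lmul6 (c d e g c' d' e' g' : 'F_p) :
    lmul (row6 0 0 c d e g) (row6 0 0 c' d' e' g')
    = row6 0 0 (c + c') (d + d') (e + e') (g + g').
  by rewrite /lmul !co_row6 !carry0 //; congr row6; ring.
have pow6 (t c d e g : 'F_p) : lpow (row6 0 0 c d e g) t = t *: row6 0 0 c d e g.
  by rewrite lpow_center // -scaler_nat natr_Zp.
rewrite lmul_pow // xpE // ypE // xxyE // xyyE // !pow6 !scale6.
rewrite !mulr0 !mulr1 !lmul6 !add0r !addr0.
by rewrite /lmul !co_row6 !carry0 // {1}[a]row6E; congr row6; ring.
Qed.

(** Automorphisms preserve powers and associators, so the normal form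
    determines them by the images of x and y. *)
Lemma laut_ext f g : is_laut f -> is_laut g ->
  f (gx p) = g (gx p) -> f (gy p) = g (gy p) -> f =1 g.
Proof.
move=> fA gA ex ey a.
have fM := 'forall_forallP fA; have gM := 'forall_forallP gA.
rewrite [a]generation /xp /yp /xxy /xyy.
rewrite !(eqP (fM _ _)) !(eqP (gM _ _)) !laut_lpow // !laut_associator //.
by rewrite ex ey.
Qed.

Lemma is_hatP rho f : rho \in unitmx -> reflect (f =1 hat_fun rho) (is_hat rho f).
Proof.
move=> Urho; pose g := perm (hat_fun_inj Urho).
have gA : is_laut g.
  by apply/'forall_forallP => a b; rewrite !permE hat_fun_lmul.
apply: (iffP and3P) => [[fA /eqP fx /eqP fy] a|e].
  by rewrite (laut_ext fA gA) ?permE // ?fx ?fy ?hat_fun_gx ?hat_fun_gy.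
have -> : f = g by apply/permP => a; rewrite e permE.
by split=> //; rewrite permE ?hat_fun_gx ?hat_fun_gy.
Qed.

Lemma mem_Gorbit (N : {vspace vec}) (S : {set vec}) :
  reflect (exists2 rho, rho \in unitmx & S = hat_fun rho @: [set v in N])
          (S \in Gorbit N).
Proof.
apply: (iffP imsetP) => [[f + ->]|[rho Urho ->]].
  rewrite inE => /exists_inP[rho Urho /(is_hatP _ Urho) e].
  by exists rho => //; apply: eq_imset.
exists (perm (hat_fun_inj Urho)).
  rewrite inE; apply/exists_inP; exists rho => //.
  by apply/is_hatP => // a; rewrite permE.
by apply: eq_imset => a; rewrite permE.
Qed.

(** * Hyperplanes of the center *)

(** The functional on the center with coefficients u on the basis (x^p, y^p) of
    V and w on the basis ((x,x,y), (x,y,y)) of W. *)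
Definition pairing (u w : 'cV['F_p]_2) z : 'F_p :=
  co z 3 * u 0 0 + co z 4 * u 1 0 + co z 5 * w 0 0 + co z 6 * w 1 0.

Definition hyperplane (u w : 'cV['F_p]_2) : {set vec} :=
  [set z in lcenter p | pairing u w z == 0].

Implicit Types (u w : 'cV['F_p]_2).

Lemma pairingD u w a b : pairing u w (a + b) = pairing u w a + pairing u w b.
Proof. by rewrite /pairing !coD; ring. Qed.

Lemma pairingZ u w t a : pairing u w (t *: a) = t * pairing u w a.
Proof. by rewrite /pairing !coZ; ring. Qed.

Lemma in_hyperplane u w z :
  (z \in hyperplane u w) = (z \in lcenter p) && (pairing u w z == 0).
Proof. by rewrite in_set. Qed.

Lemma hyperplaneP u w z :
  reflect [/\ co z 1 = 0, co z 2 = 0 & pairing u w z = 0]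
          (z \in hyperplane u w).
Proof.
rewrite in_hyperplane.
apply: (iffP andP) => [[/(lcenterP p_pr)[z1 z2] /eqP]|[z1 z2 e]] //.
by split; [apply/lcenterP | apply/eqP].
Qed.

Lemma pairing_hat_fun rho u w z : z \in lcenter p ->
  pairing u w (hat_fun rho z) = pairing (rho *m u) (\det rho *: (rho *m w)) z.
Proof.
case/(lcenterP p_pr) => z1 z2.
rewrite /pairing /hat_fun !co_row6 z1 z2 /wrap !muln0 div0n /cubic.
by rewrite !scale_colE !mulmx2E; ring.
Qed.

Lemma hat_fun_center rho z : rho \in unitmx ->
  (hat_fun rho z \in lcenter p) = (z \in lcenter p).
Proof.
move=> Urho; apply/(lcenterP p_pr)/(lcenterP p_pr); rewrite /hat_fun !co_row6.
  by case=> e1 e2; apply: (unitmx2_inj Urho); rewrite !mul0r addr0.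
by case=> -> ->; rewrite !mul0r addr0.
Qed.

Lemma hat_fun_hyperplane rho u w : rho \in unitmx ->
  hat_fun rho @: hyperplane (rho *m u) (\det rho *: (rho *m w)) = hyperplane u w.
Proof.
move=> Urho; apply/setP => z.
have /codomP[y ->] := injF_onto (hat_fun_inj Urho) z.
rewrite mem_imset; last exact: hat_fun_inj.
rewrite !in_hyperplane hat_fun_center //; case: (boolP (y \in _)) => //= yZ.
by rewrite pairing_hat_fun.
Qed.

Lemma hyperplaneZ (t : 'F_p) u w : t != 0 ->
  hyperplane (t *: u) (t *: w) = hyperplane u w.
Proof.
move=> t0; apply/setP => z; rewrite !in_hyperplane; congr (_ && _).
have -> : pairing (t *: u) (t *: w) z = t * pairing u w z.
  by rewrite /pairing !mxE; ring.
by rewrite mulf_eq0 (negPf t0).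
Qed.

(** If (h_k) are the coefficients of the first functional, the vector
    h_j e_i - h_i e_j lies in its kernel, so all 2 x 2 minors of the two
    functionals vanish. *)
Lemma hyperplane_subset u w u' w' : (u != 0) || (w != 0) ->
  hyperplane u w \subset hyperplane u' w' ->
  exists t, u' = t *: u /\ w' = t *: w.
Proof.
move=> nz /subsetP sub.
have test (c d e g : 'F_p) : c * u 0 0 + d * u 1 0 + e * w 0 0 + g * w 1 0 = 0 ->
    c * u' 0 0 + d * u' 1 0 + e * w' 0 0 + g * w' 1 0 = 0.
  move=> h; have := sub (row6 0 0 c d e g).
  rewrite !in_hyperplane; have -> : row6 0 0 c d e g \in lcenter p.
    by apply/lcenterP; rewrite // !co_row6.
  by rewrite /pairing !co_row6 h eqxx => /(_ isT)/eqP.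
have minor (s s' k k' : 'F_p) : s != 0 -> s' * k - s * k' = 0 -> k' = s' / s * k.
  move=> s0 /subr0_eq e; apply: (mulfI s0).
  by rewrite -e; field.
pose h : seq 'F_p := [:: u 0 0; u 1 0; w 0 0; w 1 0].
pose h' : seq 'F_p := [:: u' 0 0; u' 1 0; w' 0 0; w' 1 0].
have minors (i j : nat) : (i < 4)%N -> (j < 4)%N -> h'`_i * h`_j - h`_i * h'`_j = 0.
  move=> i4 j4.
  have := test (h`_j * (i == 0)%:R - h`_i * (j == 0)%:R)
               (h`_j * (i == 1)%:R - h`_i * (j == 1)%:R)
               (h`_j * (i == 2)%:R - h`_i * (j == 2)%:R)
               (h`_j * (i == 3)%:R - h`_i * (j == 3)%:R).
  case: i i4 => [|[|[|[|//]]]] _; case: j j4 => [|[|[|[|//]]]] _ /= e;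
    (rewrite -[RHS]e; first by ring); ring.
have [i i4 hi] : exists2 i, (i < 4)%N & h`_i != 0.
  have [u0|u0] := eqVneq (u 0 0) 0; last by exists 0.
  have [u1|u1] := eqVneq (u 1 0) 0; last by exists 1.
  have [w0|w0] := eqVneq (w 0 0) 0; last by exists 2.
  have [w1|w1] := eqVneq (w 1 0) 0; last by exists 3.
  by case/orP: nz => /eqP[]; apply: eq_col2; rewrite mxE.
exists (h'`_i / h`_i).
have prop j : (j < 4)%N -> h'`_j = h'`_i / h`_i * h`_j.
  by move=> j4; apply: minor => //; apply: minors.
split; apply: eq_col2; rewrite scale_colE.
- exact: (prop 0).
- exact: (prop 1).
- exact: (prop 2).
- exact: (prop 3).
Qed.

(** * Orbits of functionals *)

(** The functional of the image is obtained from (u0, w0) by the inverse of the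
    dual action. *)
Lemma orbit_is_hyperplane (N : {vspace vec}) u0 w0 S :
  [set v in N] = hyperplane u0 w0 -> S \in Gorbit N ->
  exists rho u w, [/\ rho \in unitmx, S = hyperplane u w, u0 = rho *m u
    & w0 = \det rho *: (rho *m w)].
Proof.
move=> eN /mem_Gorbit[rho Urho ->].
exists rho, (invmx rho *m u0), ((\det rho)^-1 *: (invmx rho *m w0)).
have d0 : \det rho != 0 by rewrite -unitfE -unitmxE.
have eu : u0 = rho *m (invmx rho *m u0) by rewrite mulKVmx.
have ew : w0 = \det rho *: (rho *m ((\det rho)^-1 *: (invmx rho *m w0))).
  by rewrite -scalemxAr mulKVmx // scalerA mulfV // scale1r.
by split=> //; rewrite eN {1}eu {1}ew hat_fun_hyperplane.
Qed.

(** The orbit relation of GL_2 on functionals up to scalars. *)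
Definition equivalent u0 w0 u w : Prop :=
  exists rho t, [/\ rho \in unitmx, t != 0, rho *m u = t *: u0
    & \det rho *: (rho *m w) = t *: w0].

Lemma mem_orbit (N : {vspace vec}) u0 w0 u w :
  [set v in N] = hyperplane u0 w0 ->
  (u0 != 0) || (w0 != 0) -> (u != 0) || (w != 0) ->
  hyperplane u w \in Gorbit N <-> equivalent u0 w0 u w.
Proof.
move=> eN nz0 nz.
split=> [/(orbit_is_hyperplane eN)[rho [u1 [w1 [Urho e eu ew]]]]|].
  have [] := @hyperplane_subset u w u1 w1 nz; first by rewrite e.
  move=> t [eu1 ew1]; rewrite {}eu1 {}ew1 in eu ew.
  rewrite -scalemxAr in eu; rewrite -scalemxAr scalerA mulrC -scalerA in ew.
  have t0 : t != 0.
    by apply: contraTneq nz0 => t0; rewrite eu ew t0 !scale0r eqxx.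
  exists rho, t^-1; split; rewrite ?invr_eq0 //.
    by rewrite eu [RHS]scalerA mulVf // scale1r.
  by rewrite ew [RHS]scalerA mulVf // scale1r.
case=> rho [t [Urho t0 eu ew]]; apply/mem_Gorbit; exists rho => //.
by rewrite eN -(hyperplaneZ u0 w0 t0) -eu -ew hat_fun_hyperplane.
Qed.

(** The determinant of the 2 x 2 matrix with columns u and w. *)
Definition cross u w : 'F_p := u 0 0 * w 1 0 - u 1 0 * w 0 0.

Lemma cross_act rho u w :
  cross (rho *m u) (\det rho *: (rho *m w)) = (\det rho) ^+ 2 * cross u w.
Proof. by rewrite /cross !scale_colE !mulmx2E det_mx22; ring. Qed.

Lemma dual_vector u : u != 0 -> exists v1 v2, v1 * u 0 0 + v2 * u 1 0 = 1.
Proof.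
move=> nz; have [u0|u0] := eqVneq (u 0 0) 0; last first.
  by exists (u 0 0)^-1, 0; rewrite mulVf // mul0r addr0.
have [u1|u1] := eqVneq (u 1 0) 0; last first.
  by exists 0, (u 1 0)^-1; rewrite mulVf // mul0r add0r.
by case/eqP: nz; apply: eq_col2; rewrite mxE.
Qed.

Lemma unit_mul_eq0 rho u : rho \in unitmx -> (rho *m u == 0) = (u == 0).
Proof.
move=> Urho; apply/eqP/eqP => [e|->]; last by rewrite mulmx0.
by rewrite -(mulKmx Urho u) e mulmx0.
Qed.

Lemma unit_det_neq0 rho : (rho \in unitmx) = (\det rho != 0).
Proof. by rewrite unitmxE unitfE. Qed.

Lemma equivalent_zero u0 w0 u w : equivalent u0 w0 u w ->
  ((u == 0) = (u0 == 0)) * ((w == 0) = (w0 == 0)).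
Proof.
case=> rho [t [Urho t0 eu ew]]; split.
  by rewrite -(unit_mul_eq0 u Urho) eu scaler_eq0 (negPf t0).
have := congr1 (fun x => x == 0) ew; rewrite !scaler_eq0 (negPf t0).
by move: Urho (Urho); rewrite {1}unit_det_neq0 => /negPf -> /unit_mul_eq0 ->.
Qed.

Lemma equivalent_cross u0 w0 u w : equivalent u0 w0 u w ->
  exists2 s, s != 0 & s ^+ 2 * cross u w = cross u0 w0.
Proof.
case=> rho [t [Urho t0 eu ew]]; exists (\det rho / t).
  by rewrite mulf_neq0 ?invr_eq0 // -unit_det_neq0.
rewrite exprMn mulrAC -cross_act eu ew /cross !scale_colE.
by field.
Qed.

(** A matrix of determinant 1 sends u to (0, 1): its first row is orthogonal
    to u, its second row takes the value 1 on u. *)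
Lemma equivalent_w0 u w : (u != 0) || (w != 0) ->
  equivalent (col2 0 1) 0 u w <-> w = 0.
Proof.
move=> nz; split=> [/equivalent_zero[_]|ew]; first by rewrite eqxx => /eqP.
move: nz; rewrite {}ew eqxx orbF => /dual_vector[v1 [v2 e]].
have d1 : \det (mat2 (u 1 0) (- u 0 0) v1 v2) = 1.
  by rewrite det_mx22 !mat2E -e; ring.
exists (mat2 (u 1 0) (- u 0 0) v1 v2), 1.
rewrite unit_det_neq0 d1 oner_eq0 !scale1r; split=> //.
- by apply: eq_col2; rewrite mulmx2E !mat2E !col2E -?e; ring.
- by rewrite mulmx0.
Qed.

Lemma equivalent_u0 u w : (u != 0) || (w != 0) ->
  equivalent 0 (col2 0 1) u w <-> u = 0.
Proof.
move=> nz; split=> [/equivalent_zero[+ _]|eu]; first by rewrite eqxx => /eqP.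
move: nz; rewrite {}eu eqxx /= => /dual_vector[v1 [v2 e]].
have d1 : \det (mat2 (w 1 0) (- w 0 0) v1 v2) = 1.
  by rewrite det_mx22 !mat2E -e; ring.
exists (mat2 (w 1 0) (- w 0 0) v1 v2), 1.
rewrite unit_det_neq0 d1 oner_eq0 mulmx0 scaler0 !scale1r; split=> //.
by apply: eq_col2; rewrite mulmx2E !mat2E !col2E -?e; ring.
Qed.

(** If w = c u, a matrix of determinant k sending u to (0, 1) sends (u, w) to
    the pair of (0, 1) and (0, k c), and k can be chosen with k c = -1. *)
Lemma equivalent_parallel u w :
  equivalent (col2 0 1) (col2 0 (-1)) u w
  <-> [/\ u != 0, w != 0 & cross u w = 0].
Proof.
split=> [eqv|[unz wnz c0]].
  have n0 (b : 'F_p) : b != 0 -> col2 0 b != 0.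
    by apply: contraNneq => /(congr1 (fun v : 'cV_2 => v 1 0)); rewrite col2E mxE => ->.
  have [-> ->] := equivalent_zero eqv; rewrite !n0 ?oppr_eq0 ?oner_eq0 //; split=> //.
  have [s s0] := equivalent_cross eqv.
  rewrite /cross !col2E !mul0r mulr0 subrr => /eqP.
  by rewrite mulf_eq0 sqrf_eq0 (negPf s0) => /eqP.
have [v1 [v2 e]] := dual_vector unz.
pose c := v1 * w 0 0 + v2 * w 1 0.
have ew : w = c *: u.
  apply: eq_col2; rewrite scale_colE; apply/eqP; rewrite -subr_eq0; apply/eqP.
    transitivity (v2 * - cross u w); last by rewrite c0 oppr0 mulr0.
    by rewrite -[w 0 0]mul1r -e /c /cross; ring.
  transitivity (v1 * cross u w); last by rewrite c0 mulr0.
  by rewrite -[w 1 0]mul1r -e /c /cross; ring.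
have cnz : c != 0 by apply: contraNneq wnz => c_0; rewrite ew c_0 scale0r.
pose k := - c^-1; pose m := mat2 (k * u 1 0) (- k * u 0 0) v1 v2.
have dm : \det m = k.
  rewrite det_mx22 !mat2E -[RHS]mulr1 -e; ring.
exists m, 1; rewrite unit_det_neq0 dm oner_eq0 !scale1r; split=> //.
- by rewrite oppr_eq0 invr_eq0.
- by apply: eq_col2; rewrite mulmx2E !mat2E !col2E -?e; ring.
- rewrite {1}ew; apply: eq_col2; rewrite scale_colE mulmx2E !scale_colE !mat2E col2E.
    by ring.
  transitivity (k * c * (v1 * u 0 0 + v2 * u 1 0)); first by ring.
  by rewrite e mulr1 /k mulNr mulVf.
Qed.

(** [equivalent_cross] gives the necessity of the condition. Conversely, the
    rows of rho are multiples of the linear forms killing w and u respectively;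
    with the factors 1 and s, the pair (u, w) is sent to the pair of
    [cross u w] (1, 0) and s^2 [cross u w]^2 (0, 1). *)
Lemma equivalent_skew lam u w : lam != 0 ->
  equivalent (col2 1 0) (col2 0 (- lam)) u w
  <-> exists s, s ^+ 2 * cross u w = - lam.
Proof.
move=> lam0; split=> [/equivalent_cross[s _]|[s e]].
  by rewrite /cross !col2E mul1r mulr0 subr0; exists s.
have : s ^+ 2 * cross u w != 0 by rewrite e oppr_eq0.
rewrite mulf_eq0 sqrf_eq0 negb_or => /andP[s0 c0].
pose m := mat2 (w 1 0) (- w 0 0) (- s * u 1 0) (s * u 0 0).
have dm : \det m = s * cross u w.
  by rewrite det_mx22 !mat2E /cross; ring.
exists m, (cross u w); rewrite unit_det_neq0 dm mulf_neq0 //; split=> //.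
- by apply: eq_col2; rewrite scale_colE mulmx2E !mat2E !col2E /cross; ring.
- apply: eq_col2; rewrite !scale_colE mulmx2E !mat2E !col2E.
    by ring.
  by rewrite -e /cross; ring.
Qed.


(** * Subspaces of dimension 3 of the center *)

(** The matrix of z |-> (z_1, z_2, pairing u w z), whose kernel is the
    hyperplane: the first two coordinates cut out the center. *)
Definition hyp_mx u w : 'M['F_p]_(6, 3) :=
  \matrix_(i < 6, j < 3)
    (nth [::] [:: [:: 1]; [:: 0; 1];
                  [:: 0; 0; u 0 0; u 1 0; w 0 0; w 1 0]] j)`_i.

Definition hyp_fun u w : 'Hom(vec, 'rV['F_p]_3) := linfun (mulmxr (hyp_mx u w)).

Definition hyp_vs u w : {vspace vec} := lker (hyp_fun u w).

Lemma mul_hyp_mx u w z :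
  z *m hyp_mx u w = \row_j [:: co z 1; co z 2; pairing u w z]`_j.
Proof.
rewrite {1}[z]row6E; apply/rowP => j; rewrite !mxE !big_ord_recl big_ord0 !mxE /=.
by rewrite /pairing; case: j => [[|[|[|//]]]] _ /=; ring.
Qed.

Lemma mem_hyp_vs u w z : (z \in hyp_vs u w) = (z \in hyperplane u w).
Proof.
rewrite memv_ker lfunE /= mul_hyp_mx; apply/eqP/hyperplaneP => [/rowP e|[z1 z2 e]].
  by have := e 0; have := e 1; have := e 2%:R; rewrite !mxE /=.
by apply/rowP => j; rewrite !mxE z1 z2 e; case: j => [[|[|[|?]]] ?] //=.
Qed.

Lemma hyp_vsE u w : [set v in hyp_vs u w] = hyperplane u w.
Proof. by apply/setP => z; rewrite in_set mem_hyp_vs. Qed.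

(** The map z |-> (z_1, z_2, pairing u w z) from dimension 6 to dimension 3 is
    onto. *)
Lemma dim_hyp_vs u w : (u != 0) || (w != 0) -> \dim (hyp_vs u w) = 3.
Proof.
move=> nz.
have [z0 [z1 z2 z3]] :
    exists z, [/\ co z 1 = 0, co z 2 = 0 & pairing u w z = 1].
  case/orP: nz => /dual_vector[v1 [v2 e]].
    by exists (row6 0 0 v1 v2 0 0); rewrite /pairing !co_row6 -e; split=> //; ring.
  by exists (row6 0 0 0 0 v1 v2); rewrite /pairing !co_row6 -e; split=> //; ring.
have full : limg (hyp_fun u w) = fullv.
  apply/vspaceP => y; rewrite memvf; apply/idP.
  apply/memv_imgP; exists (row6 (y 0 0) (y 0 1) 0 0 0 0 + y 0 2%:R *: z0).
    by rewrite memvf.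
  rewrite lfunE /= mul_hyp_mx pairingD pairingZ !coD !coZ !co_row6 z1 z2 z3.
  rewrite {1}/pairing !co_row6.
  apply/rowP => -[[|[|[|//]]] lt_j3]; rewrite [RHS]mxE /=.
  - by rewrite mulr0 addr0; congr (y _ _); apply/val_inj.
  - by rewrite mulr0 addr0; congr (y _ _); apply/val_inj.
  - by rewrite !mul0r !add0r mulr1; congr (y _ _); apply/val_inj.
have := limg_ker_dim (hyp_fun u w) fullv.
by rewrite capfv full !dimvf /dim /= => /eqP; rewrite (eqn_add2r 3 _ 3) => /eqP.
Qed.

(** Evaluating functionals on a basis of U is a linear map from dimension 4 to
    dimension 3; a nonzero element of its kernel defines a hyperplane
    containing U, which equals U by dimension. *)
Lemma center_subspace_hyperplane (U : {vspace vec}) :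
  [set v in U] \subset lcenter p -> \dim U = 3 ->
  exists u w, (u != 0) || (w != 0) /\ [set v in U] = hyperplane u w.
Proof.
move=> /subsetP sub dimU.
pose C : 'M['F_p]_(4, \dim U) := \matrix_(i, j) co (vbasis U)`_j i.+3.
have /rowV0Pn[h /sub_kermxP hC h0] : kermx C != 0.
  rewrite -mxrank_eq0 mxrank_ker -lt0n subn_gt0.
  by rewrite (leq_ltn_trans (rank_leq_col C)) // dimU.
pose u := col2 (h 0 0) (h 0 1); pose w := col2 (h 0 2%:R) (h 0 3%:R).
have nz : (u != 0) || (w != 0).
  apply: contraNT h0; rewrite negb_or !negbK => /andP[/eqP/colP eu /eqP/colP ew].
  apply/eqP/rowP => -[[|[|[|[|//]]]] i]; rewrite [RHS]mxE.
  - by have := eu 0; rewrite !mxE /= => <-; congr (h _ _); apply/val_inj.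
  - by have := eu 1; rewrite !mxE /= => <-; congr (h _ _); apply/val_inj.
  - by have := ew 0; rewrite !mxE /= => <-; congr (h _ _); apply/val_inj.
  - by have := ew 1; rewrite !mxE /= => <-; congr (h _ _); apply/val_inj.
exists u, w; split=> //.
have sUH : (U <= hyp_vs u w)%VS.
  rewrite -{1}(span_basis (vbasisP U)); apply/span_subvP => b bU.
  rewrite mem_hyp_vs in_hyperplane; apply/andP; split.
    by apply: sub; rewrite in_set vbasis_mem.
  have bsz : (index b (vbasis U) < \dim U)%N.
    by rewrite -[X in (_ < X)%N](size_tuple (vbasis U)) index_mem.
  have /rowP/(_ (Ordinal bsz)) := hC; rewrite !mxE => e.
  apply/eqP; rewrite -{}e !big_ord_recl big_ord0 !mxE /= nth_index // /pairing !col2E.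
  have o1 : lift ord0 ord0 = 1 :> 'I_4 by apply/val_inj.
  have o2 : lift ord0 (lift ord0 ord0) = 2%:R :> 'I_4 by apply/val_inj.
  have o3 : lift ord0 (lift ord0 (lift ord0 ord0)) = 3%:R :> 'I_4 by apply/val_inj.
  by rewrite o3 o2 o1 /bump /= -[ord0]/(0 : 'I_4); ring.
have /eqP -> : U == hyp_vs u w by rewrite eqEdim sUH dim_hyp_vs // dimU.
exact: hyp_vsE.
Qed.

Lemma span3_hyperplane a b c u w :
  a \in hyperplane u w -> b \in hyperplane u w -> c \in hyperplane u w ->
  (forall z, z \in hyperplane u w ->
     exists x y t, z = x *: a + y *: b + t *: c) ->
  [set v in <<[:: a; b; c]>>%VS] = hyperplane u w.
Proof.
move=> aH bH cH gen; rewrite -hyp_vsE.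
have sub : (<<[:: a; b; c]>> <= hyp_vs u w)%VS.
  by apply/span_subvP => v; rewrite !inE => /or3P[]/eqP->; rewrite mem_hyp_vs.
apply/setP => z; rewrite !in_set; apply/idP/idP => [/(subvP sub)//|].
rewrite mem_hyp_vs => /gen[x [y [t ->]]].
by rewrite !memvD ?memvZ // memv_span // !inE eqxx ?orbT.
Qed.

(** * The five orbits *)
Lemma row6_center (z : vec) : z \in lcenter p ->
  z = co z 3 *: xp p + co z 4 *: yp p + co z 5 *: xxy p + co z 6 *: xyy p.
Proof.
case/(lcenterP p_pr) => z1 z2; rewrite xpE // ypE // xxyE // xyyE //.
rewrite [LHS]row6E [RHS]row6E !coD !coZ !co_row6 z1 z2; congr row6; ring.
Qed.

Lemma O1_hyperplane : [set v in (<[xp p]> + WF p)%VS] = hyperplane (col2 0 1) 0.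
Proof.
rewrite /WF -[<[xyy p]>%VS]addv0 -(span_nil vec) -!span_cons.
have inH a : co a 1 = 0 -> co a 2 = 0 -> co a 4 = 0 ->
    a \in hyperplane (col2 0 1) 0.
  by move=> a1 a2 a4; apply/hyperplaneP; rewrite /pairing !col2E !mxE a4; split=> //; ring.
apply: span3_hyperplane.
- by rewrite xpE // inH ?co_row6.
- by rewrite xxyE // inH ?co_row6.
- by rewrite xyyE // inH ?co_row6.
move=> z zH; exists (co z 3), (co z 5), (co z 6).
move: (zH); rewrite in_hyperplane => /andP[/row6_center ez /eqP].
rewrite /pairing !col2E !mxE => e4; rewrite {1}ez.
have -> : co z 4 = 0 by rewrite -[RHS]e4; ring.
by rewrite scale0r addr0.
Qed.

Lemma O2_hyperplane : [set v in (VF p + <[xxy p]>)%VS] = hyperplane 0 (col2 0 1).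
Proof.
rewrite /VF -addvA -[<[xxy p]>%VS]addv0 -(span_nil vec) -!span_cons.
have inH a : co a 1 = 0 -> co a 2 = 0 -> co a 6 = 0 ->
    a \in hyperplane 0 (col2 0 1).
  by move=> a1 a2 a6; apply/hyperplaneP; rewrite /pairing !col2E !mxE a6; split=> //; ring.
apply: span3_hyperplane.
- by rewrite xpE // inH ?co_row6.
- by rewrite ypE // inH ?co_row6.
- by rewrite xxyE // inH ?co_row6.
move=> z zH; exists (co z 3), (co z 4), (co z 5).
move: (zH); rewrite in_hyperplane => /andP[/row6_center ez /eqP].
rewrite /pairing !col2E !mxE => e6; rewrite {1}ez.
have -> : co z 6 = 0 by rewrite -[RHS]e6; ring.
by rewrite scale0r addr0.
Qed.

Lemma O3_hyperplane :
  [set v in <<[:: xp p; (yp p + xyy p)%R; xxy p]>>%VS]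
  = hyperplane (col2 0 1) (col2 0 (-1)).
Proof.
have inH a : co a 1 = 0 -> co a 2 = 0 -> co a 4 = co a 6 ->
    a \in hyperplane (col2 0 1) (col2 0 (-1)).
  by move=> a1 a2 e; apply/hyperplaneP; rewrite /pairing !col2E e; split=> //; ring.
apply: span3_hyperplane.
- by rewrite xpE // inH ?co_row6.
- by rewrite ypE // xyyE // inH ?coD ?co_row6 ?addr0 ?add0r.
- by rewrite xxyE // inH ?co_row6.
move=> z zH; exists (co z 3), (co z 4), (co z 5).
move: (zH); rewrite in_hyperplane => /andP[/row6_center ez /eqP].
rewrite /pairing !col2E => e46; rewrite {1}ez.
have -> : co z 6 = co z 4 by apply/esym/subr0_eq; rewrite -[RHS]e46; ring.
by rewrite scalerDr addrA -!addrA; congr (_ + (_ + _)); rewrite addrC.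
Qed.

Lemma skew_hyperplane (lam : 'F_p) :
  [set v in <<[:: yp p; (lam *: xp p + xyy p)%R; xxy p]>>%VS]
  = hyperplane (col2 1 0) (col2 0 (- lam)).
Proof.
have inH a : co a 1 = 0 -> co a 2 = 0 -> co a 3 = lam * co a 6 ->
    a \in hyperplane (col2 1 0) (col2 0 (- lam)).
  by move=> a1 a2 e; apply/hyperplaneP; rewrite /pairing !col2E e; split=> //; ring.
apply: span3_hyperplane.
- by rewrite ypE // inH ?co_row6 ?mulr0.
- by rewrite xpE // xyyE // inH ?coD ?coZ ?co_row6 ?mulr0 ?addr0 ?add0r.
- by rewrite xxyE // inH ?co_row6 ?mulr0.
move=> z zH; exists (co z 4), (co z 6), (co z 5).
move: (zH); rewrite in_hyperplane => /andP[/row6_center ez /eqP].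
rewrite /pairing !col2E => e36; rewrite {1}ez.
have -> : co z 3 = lam * co z 6 by apply/subr0_eq; rewrite -[RHS]e36; ring.
rewrite scalerDr scalerA (mulrC lam) addrAC; congr (_ + _).
by rewrite addrAC [LHS]addrC addrA.
Qed.

Lemma basis_neq0 : (col2 1 0 != 0 :> 'cV['F_p]_2) * (col2 0 1 != 0 :> 'cV['F_p]_2).
Proof.
split; apply/eqP => /colP e.
  by have := e 0; rewrite col2E mxE => /eqP; rewrite oner_eq0.
by have := e 1; rewrite col2E mxE => /eqP; rewrite oner_eq0.
Qed.

Section Orbits.
Variables (u w : 'cV['F_p]_2).
Hypothesis nz : (u != 0) || (w != 0).

Lemma mem_O1 : (hyperplane u w \in O1 p) = (w == 0).
Proof.
have nz0 : (col2 0 1 != 0 :> 'cV['F_p]_2) || (0 != 0 :> 'cV['F_p]_2).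
  by rewrite basis_neq0 ?orbT.
apply/idP/eqP; last by move/(equivalent_w0 nz)/(mem_orbit O1_hyperplane nz0 nz).
by move/(mem_orbit O1_hyperplane nz0 nz)/(equivalent_w0 nz).
Qed.

Lemma mem_O2 : (hyperplane u w \in O2 p) = (u == 0).
Proof.
have nz0 : (0 != 0 :> 'cV['F_p]_2) || (col2 0 1 != 0 :> 'cV['F_p]_2).
  by rewrite basis_neq0 ?orbT.
apply/idP/eqP; last by move/(equivalent_u0 nz)/(mem_orbit O2_hyperplane nz0 nz).
by move/(mem_orbit O2_hyperplane nz0 nz)/(equivalent_u0 nz).
Qed.

Lemma mem_O3 :
  (hyperplane u w \in O3 p) = [&& u != 0, w != 0 & cross u w == 0].
Proof.
have nz0 (b : 'F_p) : (col2 0 1 != 0 :> 'cV['F_p]_2) || (col2 0 b != 0).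
  by rewrite basis_neq0 ?orbT.
apply/idP/and3P; last first.
  case=> u0 w0 /eqP c0.
  by apply/(mem_orbit O3_hyperplane (nz0 _) nz)/equivalent_parallel.
by move/(mem_orbit O3_hyperplane (nz0 _) nz)/equivalent_parallel => -[-> -> ->].
Qed.

Lemma mem_skew (lam : 'F_p) : lam != 0 ->
  (hyperplane u w \in Gorbit <<[:: yp p; (lam *: xp p + xyy p)%R; xxy p]>>%VS)
  = [exists s, s ^+ 2 * cross u w == - lam].
Proof.
move=> lam0.
have nz0 (b : 'F_p) : (col2 1 0 != 0 :> 'cV['F_p]_2) || (col2 0 b != 0).
  by rewrite basis_neq0.
apply/idP/'exists_eqP.
  by move/(mem_orbit (skew_hyperplane lam) (nz0 _) nz)/(equivalent_skew _ _ lam0).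
by move/(equivalent_skew _ _ lam0)/(mem_orbit (skew_hyperplane lam) (nz0 _) nz).
Qed.

(** The condition s^2 [cross u w] = -1 says that - [cross u w] is the square
    of 1 / s. *)
Lemma mem_O4 :
  (hyperplane u w \in O4 p) = (cross u w != 0) && square (- cross u w).
Proof.
rewrite /O4 -[xp p]scale1r mem_skew ?oner_eq0 //.
apply/'exists_eqP/andP => [[s e]|[c0 /'exists_eqP[m e]]].
  have : s ^+ 2 * cross u w != 0 by rewrite e oppr_eq0 oner_eq0.
  rewrite mulf_eq0 sqrf_eq0 negb_or => /andP[s0 ->]; split=> //.
  apply/'exists_eqP; exists s^-1; apply: (mulfI (expf_neq0 2 s0)).
  by rewrite mulrN e opprK exprVn mulfV // expf_neq0.
have m0 : m != 0.
  by apply: contraNneq c0 => m0; rewrite -oppr_eq0 e m0 expr0n.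
exists m^-1; rewrite -[cross u w]opprK e mulrN exprVn mulVf ?expf_neq0 //.
Qed.

(** Both sides are false for p = 2, where m = m^2 for every m. For odd p
    the ratio of lambda and - [cross u w] has to be a square; as lambda is not
    a square, [nonsquare_ratio] applies. *)
Lemma mem_O5 (lam : 'F_p) : (p <> 2%N -> ~~ square lam) ->
  (hyperplane u w \in O5 lam) = ~~ square (- cross u w).
Proof.
move=> nsq; rewrite /O5; case: eqP => [p2|/nsq {}nsq].
  rewrite in_set0; apply/esym/negbF/'exists_eqP; exists (- cross u w).
  have := expf_card (- cross u w); rewrite card_Fp // => e.
  by rewrite -[LHS]e; congr (_ ^+ _).
have nsq0 x : ~~ square x -> x != 0.
  by apply: contraNneq => ->; apply/'exists_eqP; exists 0; rewrite expr0n.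
rewrite mem_skew ?nsq0 //.
apply/'exists_eqP/idP => [[s e]|nsqc].
  apply: contra nsq => /'exists_eqP[m em]; apply/'exists_eqP; exists (s * m).
  by rewrite exprMn -em mulrN e opprK.
have [s e] := nonsquare_ratio nsqc nsq; exists s.
by rewrite -e mulrN opprK.
Qed.

End Orbits.

Lemma hyperplane_subspace u w : (u != 0) || (w != 0) ->
  is_subspace_of_center 3 (hyperplane u w).
Proof.
move=> nz; exists (hyp_vs u w); rewrite hyp_vsE dim_hyp_vs //; split=> //.
by apply/subsetP => z; rewrite in_hyperplane => /andP[].
Qed.

Lemma orbit_nonzero_hyperplane (N : {vspace vec}) u0 w0 S :
  [set v in N] = hyperplane u0 w0 -> (u0 != 0) || (w0 != 0) -> S \in Gorbit N ->
  exists u w, (u != 0) || (w != 0) /\ S = hyperplane u w.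
Proof.
move=> eN nz0 /(orbit_is_hyperplane eN)[rho [u [w [_ -> eu ew]]]].
exists u, w; split=> //; apply: contraLR nz0; rewrite !negb_or !negbK.
by rewrite eu ew => /andP[/eqP-> /eqP->]; rewrite !mulmx0 scaler0 eqxx.
Qed.

End FpLoop.

Theorem proposition5p3 (p : nat) (p_pr : prime p) (p_neq3 : p <> 3%N)
    (lambda : 'F_p)
    (lambda_nonsquare : p <> 2%N -> ~ (exists m : 'F_p, lambda = m ^+ 2)) :
  (forall S : {set 'rV['F_p]_6},
     S \in O1 p :|: O2 p :|: O3 p :|: O4 p :|: O5 lambda
     <-> is_subspace_of_center 3 S)
  /\ pairwise (fun A B : {set {set 'rV['F_p]_6}} => [disjoint A & B])
       [:: O1 p; O2 p; O3 p; O4 p; O5 lambda].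
Proof.
have nsq : p <> 2%N -> ~~ square lambda.
  by move=> /lambda_nonsquare h; apply/negP => /'exists_eqP.
have orbit_hyp S : S \in O1 p :|: O2 p :|: O3 p :|: O4 p :|: O5 lambda ->
    exists u w : 'cV['F_p]_2, (u != 0) || (w != 0) /\ S = hyperplane u w.
  rewrite /O5 !inE -!orbA => /or4P[h|h|h|/orP[h|]].
  - by apply: orbit_nonzero_hyperplane h; rewrite ?O1_hyperplane // basis_neq0.
  - apply: orbit_nonzero_hyperplane h; rewrite ?O2_hyperplane //.
    by rewrite basis_neq0 ?orbT.
  - by apply: orbit_nonzero_hyperplane h; rewrite ?O3_hyperplane // basis_neq0.
  (* O4 is the case lambda = 1 of the family defining O5. *)
  - rewrite /O4 -[xp p]scale1r in h.
    by apply: orbit_nonzero_hyperplane h; rewrite ?skew_hyperplane // basis_neq0.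
  case: eqP => _ h; first by rewrite in_set0 in h.
  by apply: orbit_nonzero_hyperplane h; rewrite ?skew_hyperplane // basis_neq0.
(* These two implications turn both claims into tautologies in the truth values
   of u = 0, w = 0, cross u w = 0 and of - cross u w being a square. *)
have cross0 (u w : 'cV['F_p]_2) : (u == 0) || (w == 0) ==> (cross u w == 0).
  by apply/implyP; rewrite /cross => /orP[]/eqP->; rewrite !mxE; apply/eqP; ring.
have square0 (c : 'F_p) : (c == 0) ==> square (- c).
  by apply/implyP => /eqP->; apply/'exists_eqP; exists 0; rewrite oppr0 expr0n.
split=> [S|].
  split=> [/orbit_hyp[u [w [nz ->]]]|[U [-> sub dimU]]].
    exact: hyperplane_subspace.
  have [u [w [nz ->]]] := center_subspace_hyperplane p_pr sub dimU.
  rewrite !in_setU mem_O1 // mem_O2 // mem_O3 // mem_O4 // mem_O5 //.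
  by case: (u == 0); case: (w == 0); case: eqP; case: [exists m, _].
have disj (A B : {set {set 'rV['F_p]_6}}) :
    A \subset O1 p :|: O2 p :|: O3 p :|: O4 p :|: O5 lambda ->
    (forall u w, (u != 0) || (w != 0) ->
       hyperplane u w \in A -> hyperplane u w \notin B) -> [disjoint A & B].
  move=> /subsetP sub h; rewrite disjoints_subset; apply/subsetP => S SA.
  rewrite in_setC; have [u [w [nz eS]]] := orbit_hyp _ (sub _ SA).
  by rewrite eS h // -eS.
have sub1 : O1 p \subset O1 p :|: O2 p :|: O3 p :|: O4 p :|: O5 lambda.
  by apply/subsetP => S; rewrite !in_setU => ->.
have sub2 : O2 p \subset O1 p :|: O2 p :|: O3 p :|: O4 p :|: O5 lambda.
  by apply/subsetP => S; rewrite !in_setU => ->; rewrite ?orbT.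
have sub3 : O3 p \subset O1 p :|: O2 p :|: O3 p :|: O4 p :|: O5 lambda.
  by apply/subsetP => S; rewrite !in_setU => ->; rewrite ?orbT.
have sub4 : O4 p \subset O1 p :|: O2 p :|: O3 p :|: O4 p :|: O5 lambda.
  by apply/subsetP => S; rewrite !in_setU => ->; rewrite ?orbT.
rewrite /= !andbT -!andbA.
repeat (apply/andP; split).
all: apply: disj => // u w nz; rewrite ?mem_O1 ?mem_O2 ?mem_O3 ?mem_O4 ?mem_O5 //.
all: have := square0 (cross u w); have := cross0 u w; move: nz.
all: by case: (u == 0); case: (w == 0); case: (cross u w == 0); case: [exists m, _].
Qed.
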